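(* Let $G$ be a finite simple non-trivial graph such that each connected component of $G$ is regular or biregular and is not isomorphic to the path graph $P_3$ with three vertices. Then $$GA_1(\mathcal{L}(G))\ge GA_1(G),$$ and the equality is attained for every (disjoint) union of cycle graphs.
   Context: A graph is non-trivial if each of its connected components has at least two edges. A graph is biregular if it is bipartite and, for some bipartition, all vertices on one side have the same degree $\Delta$ and all vertices on the other side have the same degree $\delta$. For a finite simple graph $H$, with $d_u$ the degree of the vertex $u$ in $H$, the first geometric-arithmetic index is $GA_1(H)=\sum_{uv\in E(H)}\frac{2\sqrt{d_u d_v}}{d_u+d_v}$ (each edge counted once). The line graph $\mathcal{L}(G)$ has the edges of $G$ as vertices, two distinct ones being adjacent if and only if they share an endpoint in $G$. *)

(* Defs.v *)
From HB Require Import structures.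
From mathcomp Require Import all_boot all_order all_algebra.

Set Implicit Arguments.
Unset Strict Implicit.
Unset Printing Implicit Defensive.

Import Order.TTheory GRing.Theory Num.Theory.
Local Open Scope ring_scope.

Record sgraph := SGraph {
  vertex :> finType;
  adj : rel vertex;
  adj_sym : symmetric adj;
  adj_irrefl : irreflexive adj }.

Definition deg (G : sgraph) (x : G) : nat := #|[set y : G | adj x y]|.

Definition edges (G : sgraph) : {set {set G}} :=
  [set [set p.1; p.2] | p in [pred p : G * G | adj p.1 p.2]].

(* An edge is a set A = [set u; v] with u != v, so the product over A is
   d_u * d_v and the sum over A is d_u + d_v. *)
Definition GA1 (R : rcfType) (G : sgraph) : R :=
  \sum_(A in edges G)
    2 * Num.sqrt (\prod_(v in A) (deg v)%:R) / \sum_(v in A) (deg v)%:R.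

Definition graph_iso (G H : sgraph) : Prop :=
  exists2 f : G -> H, bijective f & forall x y, adj (f x) (f y) = adj x y.

Section LineGraph.
Variable G : sgraph.
Let V : finType := {A : {set G} | A \in edges G}.

Definition line_adj : rel V :=
  [rel A B | (A != B) && (val A :&: val B != set0)].

Lemma line_adj_sym : symmetric line_adj.
Proof. by move=> A B; rewrite /line_adj /= [B == A]eq_sym [val B :&: _]setIC. Qed.

Lemma line_adj_irrefl : irreflexive line_adj.
Proof. by move=> A; rewrite /line_adj /= eqxx. Qed.

Definition line_graph : sgraph := SGraph line_adj_sym line_adj_irrefl.
End LineGraph.

Section Induced.
Variables (G : sgraph) (S : {set G}).
Let V : finType := {x : G | x \in S}.

Definition induced_adj : rel V := [rel x y | adj (val x) (val y)].

Lemma induced_adj_sym : symmetric induced_adj.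
Proof. by move=> x y; rewrite /induced_adj /= adj_sym. Qed.

Lemma induced_adj_irrefl : irreflexive induced_adj.
Proof. by move=> x; rewrite /induced_adj /= adj_irrefl. Qed.

Definition induced : sgraph := SGraph induced_adj_sym induced_adj_irrefl.
End Induced.

Section PathGraph.
Variable n : nat.

Definition path_adj : rel 'I_n :=
  [rel i j : 'I_n | (i.+1 == j :> nat) || (j.+1 == i :> nat)].

Lemma path_adj_sym : symmetric path_adj.
Proof. by move=> i j; rewrite /path_adj /= orbC. Qed.

Lemma path_adj_irrefl : irreflexive path_adj.
Proof. by move=> i; rewrite /path_adj /= orbb gtn_eqF. Qed.

(* The path with n vertices. *)
Definition path_graph : sgraph := SGraph path_adj_sym path_adj_irrefl.
End PathGraph.

Section CycleGraph.
Variable n : nat.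

Definition cycle_adj : rel 'I_n.+3 := [rel i j | (j == ordS i) || (i == ordS j)].

Lemma cycle_adj_sym : symmetric cycle_adj.
Proof. by move=> i j; rewrite /cycle_adj /= orbC. Qed.

Lemma cycle_adj_irrefl : irreflexive cycle_adj.
Proof.
move=> i; rewrite /cycle_adj /= orbb; apply/negbTE/eqP => /(congr1 val) /=.
have := ltn_ord i; rewrite leq_eqVlt => /orP[/eqP i_max | lt_i].
  by rewrite i_max modnn => i0; rewrite i0 in i_max.
by rewrite modn_small // => /eqP; rewrite ltn_eqF.
Qed.

(* The cycle with n + 3 vertices, as a cycle has at least three of them. *)
Definition cycle_graph : sgraph := SGraph cycle_adj_sym cycle_adj_irrefl.
End CycleGraph.

Section DisjointUnion.
Variables (I : finType) (H : I -> sgraph).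
Let V : finType := {i : I & H i}.

(* When tag u = tag v, [tagged_as u v] is the vertex [tagged v] cast to
   H (tag u). *)
Definition dunion_adj : rel V :=
  [rel u v | (tag u == tag v) && adj (tagged u) (tagged_as u v)].

Lemma dunion_adj_sym : symmetric dunion_adj.
Proof.
move=> [i x] [j y]; rewrite /dunion_adj /=; have [eq_ij | ne_ij] := eqVneq i j => //.
by case: _ / eq_ij y => y; rewrite !tagged_asE adj_sym.
Qed.

Lemma dunion_adj_irrefl : irreflexive dunion_adj.
Proof. by move=> [i x]; rewrite /dunion_adj /= tagged_asE adj_irrefl andbF. Qed.

Definition dunion : sgraph := SGraph dunion_adj_sym dunion_adj_irrefl.
End DisjointUnion.

Definition components (G : sgraph) : {set {set G}} :=
  [set [set y | connect (@adj G) x y] | x : G].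

Definition nontrivial (G : sgraph) : Prop :=
  forall C, C \in components G -> (2 <= #|edges (induced C)|)%N.

Definition regular (G : sgraph) : Prop :=
  exists k : nat, forall x : G, deg x = k.

Definition bipartition (G : sgraph) (A : {set G}) : Prop :=
  forall x y : G, adj x y -> (x \in A) != (y \in A).

(* The two sides of the bipartition are A and its complement. *)
Definition biregular (G : sgraph) : Prop :=
  exists (A : {set G}) (D d : nat),
    [/\ bipartition A,
        forall x, x \in A -> deg x = D
      & forall x, x \notin A -> deg x = d].

Definition admissible (G : sgraph) : Prop :=
  nontrivial G /\
  forall C, C \in components G ->
    (regular (induced C) \/ biregular (induced C)) /\
    ~ graph_iso (induced C) (path_graph 3).

Definition cycle_union (G : sgraph) : Prop :=
  exists (I : finType) (n : I -> nat),
    graph_iso G (dunion (fun i => cycle_graph (n i))).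

(* Main.v *)
(* In a component that is regular or biregular all edges have the same degree
   pair, so adjacent vertices of the line graph have equal degrees and every
   edge of the line graph contributes 1 to its index: GA_1(L(G)) is the number
   of edges of L(G), that is, by the handshake lemma, the sum over the edges uv
   of G of (d_u + d_v - 2) / 2.  Excluding single edges and P_3 as components
   forces d_u + d_v >= 4, so this summand is at least 1, which by AM-GM is at
   least the contribution of uv to GA_1(G).  If all degrees are 2, both indices
   equal the number of edges of G. *)
Require Import Defs.
From mathcomp Require Import all_boot all_order all_algebra.
From mathcomp Require Import zify lra.

Set Implicit Arguments.
Unset Strict Implicit.
Unset Printing Implicit Defensive.

Import Order.TTheory GRing.Theory Num.Theory.
Local Open Scope ring_scope.

(** * Edges, incidences and degrees *)

Section SimpleGraph.
Variable G : sgraph.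
Implicit Types (x y u v w : G) (A B S C : {set G}).

Lemma adj_neq x y : adj x y -> x != y.
Proof. by apply: contraTneq => ->; rewrite adj_irrefl. Qed.

Lemma edgesP A :
  reflect (exists x y, adj x y /\ A = [set x; y]) (A \in edges G).
Proof.
apply: (iffP imsetP) => [[[x y] /= xy ->]|[x [y [xy ->]]]].
  by exists x, y.
by exists (x, y).
Qed.

Lemma set2_edges x y : adj x y -> [set x; y] \in edges G.
Proof. by move=> xy; apply/edgesP; exists x, y. Qed.

Lemma card_edge A : A \in edges G -> #|A| = 2%N.
Proof. by case/edgesP=> x [y [xy ->]]; rewrite cards2 adj_neq. Qed.

Lemma edge_eq A u v : A \in edges G -> u \in A -> v \in A -> u != v ->
  A = [set u; v].
Proof.
move=> AE uA vA uv; apply/eqP; rewrite eq_sym eqEcard cards2 uv card_edge //.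
by rewrite andbT; apply/subsetP => z /set2P[] ->.
Qed.

Lemma edge_otherP A u : A \in edges G -> u \in A ->
  exists2 v, adj u v & A = [set u; v].
Proof.
move=> /edgesP[x [y [xy ->]]] /set2P[] ->; first by exists y.
by exists x; rewrite 1?adj_sym // setUC.
Qed.

(** The map sending [y] to [[set x; y]] is injective on the neighbours of [x], and its image is the
    set of edges through [x]. *)
Lemma deg_incidence x : deg x = #|[set A in edges G | x \in A]|.
Proof.
rewrite /deg -(@card_in_imset _ _ (fun y => [set x; y])) => [|y z].
  apply: eq_card => A; rewrite inE; apply/imsetP/andP => [[y]|[AE xA]].
    by rewrite inE => xy ->; rewrite set2_edges // set21.
  by have [y xy ->] := edge_otherP AE xA; exists y; rewrite ?inE.
rewrite !inE => xy xz /setP/(_ y); rewrite !inE eqxx orbT.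
by rewrite eq_sym (negbTE (adj_neq xy)) /= => /esym/eqP.
Qed.

(** Double counting of the incidences between vertices and edges, by exchanging the two sums. *)
Lemma handshake : (\sum_(x : G) deg x = 2%N * #|edges G|)%N.
Proof.
under eq_bigr do rewrite deg_incidence -sum1_card.
under eq_bigr do under eq_bigl do rewrite inE.
rewrite (exchange_big_dep (mem (edges G))) /=; last by move=> x A _ /andP[].
rewrite mulnC -sum_nat_const; apply: eq_bigr => A AE.
by rewrite -(card_edge AE) -sum1_card; apply: eq_bigl => x; rewrite AE.
Qed.

Lemma deg_gt0 x y : adj x y -> (0 < deg x)%N.
Proof. by move=> xy; apply/card_gt0P; exists y; rewrite inE. Qed.

Lemma deg1_nbr x y z : deg x = 1%N -> adj x y -> adj x z -> z = y.
Proof.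
move=> /eqP/cards1P[t tE] xy xz.
have /set1P-> : y \in [set t] by rewrite -tE inE.
by apply/set1P; rewrite -tE inE.
Qed.

(** The neighbours of [A] are the other edges through [u] and the other edges through [v]. These two
    families are disjoint, as [A] is the only edge containing both ends. The form with [.+2] avoids
    truncated subtraction. *)
Lemma deg_line_graph (A : line_graph G) u v :
  u != v -> u \in val A -> v \in val A -> (deg A).+2 = (deg u + deg v)%N.
Proof.
move=> uv uA vA; have AE := valP A.
pose I x := [set B in edges G | x \in B].
have IA x : x \in val A -> val A \in I x by move=> xA; rewrite inE AE.
rewrite !deg_incidence -/(I u) -/(I v) (cardsD1 (val A) (I u)) IA //.
rewrite (cardsD1 (val A) (I v)) IA // addnACA add2n; congr _.+2.
rewrite /deg -(card_imset _ val_inj) -cardsUI.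
have -> : (I u :\ val A) :&: (I v :\ val A) = set0.
  apply/setP => B; rewrite !inE; apply/negP.
  move=> /andP[/and3P[/eqP BA BE uB] /and3P[_ _ vB]]; apply: BA.
  by rewrite (edge_eq BE uB vB uv) -(edge_eq AE uA vA uv).
rewrite cards0 addn0; apply: eq_card => B; rewrite !inE.
apply/imsetP/idP => [[B' + ->]|].
  rewrite inE /line_adj /= => /andP[AB /set0Pn[x /setIP[xA xB]]].
  rewrite (edge_eq AE uA vA uv) in xA.
  rewrite (valP B') (inj_eq val_inj) eq_sym AB /=.
  by case/set2P: xA xB => -> ->; rewrite ?orbT.
rewrite -!andb_orr => /and3P[BA BE uvB]; exists (Sub B BE) => //.
rewrite inE; apply/andP; split; first by rewrite eq_sym -(inj_eq val_inj).
apply/set0Pn.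
by case/orP: uvB => xB; [exists u | exists v]; rewrite inE xB ?uA ?vA.
Qed.

(** * Connected components and induced subgraphs *)

Definition component x : {set G} := [set y | connect (@adj G) x y].

Lemma component_in x : component x \in components G.
Proof. by apply/imsetP; exists x. Qed.

Lemma mem_component x : x \in component x.
Proof. by rewrite inE connect0. Qed.

Lemma component_adj x y z : y \in component x -> adj y z -> z \in component x.
Proof. by rewrite !inE => xy yz; apply: connect_trans xy (connect1 yz). Qed.

Lemma component_sub x S : x \in S ->
  (forall y z, adj y z -> y \in S -> z \in S) -> component x \subset S.
Proof.
move=> xS clS; apply/subsetP => y; rewrite inE => xy.
have cl : fingraph.closed (@adj G) S.
  by apply: intro_closed clS; apply: sym_connect_sym; apply: adj_sym.
by rewrite -(closed_connect cl xy).
Qed.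

Lemma deg_induced S (x : induced S) :
  (forall y, adj (val x) y -> y \in S) -> deg x = deg (val x).
Proof.
move=> xS; rewrite /deg -(card_imset _ val_inj); apply: eq_card => y.
rewrite inE; apply/imsetP/idP => [[z + ->]|xy]; first by rewrite inE.
by exists (Sub y (xS y xy)); rewrite ?inE.
Qed.

Lemma induced_path3 u v w : adj u v -> adj v w -> u != w -> ~~ adj u w ->
  graph_iso (induced [set u; v; w]) (path_graph 3).
Proof.
move=> uv vw uw nuw; have uNv := adj_neq uv; have vNw := adj_neq vw.
pose f (x : induced [set u; v; w]) : path_graph 3 :=
  if val x == u then inord 0 else if val x == v then inord 1 else inord 2.
have caseS (x : induced [set u; v; w]) : [\/ val x = u, val x = v | val x = w].
  have := valP x; rewrite !inE -orbA => /or3P[] /eqP ->;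
  by [constructor 1|constructor 2|constructor 3].
have uv0 := negbTE uNv; have uw0 := negbTE uw; have vw0 := negbTE vNw.
have nuw0 := negbTE nuw.
have f_inj : injective f.
  move=> x y; rewrite /f => /(congr1 val) fxy; apply: val_inj; move: fxy.
  case: (caseS x) => ->; case: (caseS y) => -> //;
  by rewrite !(eqxx, uv0, uw0, vw0, eq_sym v u, eq_sym w u,
    eq_sym w v) /= !inordK.
exists f.
  apply: inj_card_bij f_inj _.
  by rewrite card_ord card_sig setUC cardsU1 cards2 !inE uNv negb_or
    !(eq_sym w) uw vNw.
move=> x y; rewrite /= /path_adj /induced_adj /f /=.
case: (caseS x) => ->; case: (caseS y) => ->;
by rewrite !(eqxx, uv0, uw0, vw0, eq_sym v u, eq_sym w u,
    eq_sym w v) /= !inordK //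
   ?adj_irrefl ?uv ?vw ?nuw0 // adj_sym ?uv ?vw ?nuw0.
Qed.

(** This is how regularity and biregularity enter the argument: in the biregular case, two steps
    along edges lead back to the same side of the bipartition. *)
Lemma balanced_of_components :
  (forall C, C \in components G ->
     regular (induced C) \/ biregular (induced C)) ->
  forall u v w, adj u v -> adj v w -> deg u = deg w.
Proof.
move=> comp u v w uv vw.
have uC := mem_component u; have vC := component_adj uC uv.
have wC := component_adj vC vw.
have degC x (xC : x \in component u) :
    deg (Sub x xC : induced (component u)) = deg x.
  by rewrite deg_induced //= => y; apply: component_adj.
rewrite -(degC _ uC) -(degC _ wC).
case: (comp _ (component_in u)) => [[k dk]|[A [D [d [bip degA degNA]]]]].
  by rewrite !dk.
have /bip : adj (Sub u uC : induced (component u)) (Sub v vC) by [].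
have /bip : adj (Sub v vC : induced (component u)) (Sub w wC) by [].
(* Both edges change side, so the only surviving cases have [u] and [w] both outside [A] or both
   inside it. *)
case: (boolP (Sub v vC \in A)); case: (boolP (Sub u uC \in A));
  case: (boolP (Sub w wC \in A)) => // wA uA _ _ _.
- by rewrite !degNA.
- by rewrite !degA.
Qed.

End SimpleGraph.

(** * Degree sums over edges *)

Section Bounds.
Variable G : sgraph.
Implicit Types u v w : G.

(** The pair [[set u; v]] is closed under adjacency, so the component has at most two vertices, all
    of degree 1; the handshake lemma then leaves at most one edge. *)
Lemma single_edge_trivial u v :
  adj u v -> deg u = 1%N -> deg v = 1%N -> ~ nontrivial G.
Proof.
move=> uv du dv /(_ _ (component_in u)).
have vu : adj v u by rewrite adj_sym.
have sub : component u \subset [set u; v].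
  apply: component_sub => [|y z + /set2P[] yE]; rewrite ?set21 //= yE => yz.
    by rewrite (deg1_nbr du uv yz) set22.
  by rewrite (deg1_nbr dv vu yz) set21.
suff : (2 * #|edges (induced (component u))| <= 2)%N by lia.
rewrite -handshake (eq_bigr (fun=> 1%N)) => [|x _].
  rewrite sum1_card card_sig; apply: leq_trans (subset_leq_card sub) _.
  by rewrite cards2; case: eqP.
rewrite deg_induced; last by move=> y; apply: component_adj (valP x).
by case/set2P: (subsetP sub _ (valP x)) => ->.
Qed.

Lemma path3_component u v : adj u v -> deg u = 1%N -> deg v = 2%N ->
  (forall w, adj v w -> deg w = 1%N) ->
  exists2 C, C \in components G & graph_iso (induced C) (path_graph 3).
Proof.
move=> uv du dv dw; have vu : adj v u by rewrite adj_sym.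
(* The third vertex [w] of the path is the neighbour of [v] other than [u]. *)
have: (#|[set y | adj v y] :\ u| == 1)%N.
  by have := cardsD1 u [set y | adj v y]; rewrite inE vu -/(deg v) dv; lia.
case/cards1P=> w wE.
have /setD1P[wu] : w \in [set y | adj v y] :\ u by rewrite wE set11.
rewrite inE => vw; have wv : adj w v by rewrite adj_sym.
have nuw : ~~ adj u w.
  by apply/negP => uw; have := adj_neq vw; rewrite (deg1_nbr du uv uw) eqxx.
exists (component u); first exact: component_in.
suff -> : component u = [set u; v; w].
  by apply: induced_path3; rewrite // eq_sym.
apply/eqP; rewrite eqEsubset; apply/andP; split; last first.
  have uC := mem_component u; have vC := component_adj uC uv.
  apply/subsetP => y; rewrite !inE -orbA => /or3P[] /eqP->.
  - by rewrite -[connect _ _ _]inE.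
  - by move: vC; rewrite inE.
  - by have := component_adj vC vw; rewrite inE.
(* No edge leaves the three vertices: [u] and [w] have [v] as sole neighbour, and [v] has only [u]
   and [w]. *)
apply: component_sub => [|y z yz]; first by rewrite !inE eqxx.
rewrite !inE -orbA => /or3P[] /eqP yE; rewrite yE in yz.
- by rewrite (deg1_nbr du uv yz) eqxx orbT.
- have [-> //|zu] := eqVneq z u; rewrite orbC.
  have : z \in [set y | adj v y] :\ u by rewrite !inE zu.
  by rewrite wE inE => ->.
- by rewrite (deg1_nbr (dw w vw) wv yz) eqxx orbT.
Qed.

Lemma admissible_deg_sum u v : admissible G -> adj u v ->
  (4 <= deg u + deg v)%N.
Proof.
move=> [ntG comp] uv; have vu : adj v u by rewrite adj_sym.
have bal := balanced_of_components (fun C CG => proj1 (comp C CG)).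
(* By [bal], every neighbour of [y] has the degree of [x], namely 1, so the component would be a
   path on three vertices. *)
have no_path3 (x y : G) : adj x y -> deg x = 1%N -> deg y = 2%N -> False.
  move=> xy dx dy; have [|C CG] := path3_component xy dx dy.
    by move=> w yw; rewrite -(bal _ _ _ xy yw).
  by case: (comp C CG).
have du0 := deg_gt0 uv; have dv0 := deg_gt0 vu.
rewrite leqNgt; apply/negP => lt4.
have [|[]] : (deg u = 1 /\ deg v = 1 \/ (deg u = 1 /\ deg v = 2%N) \/
           (deg v = 1 /\ deg u = 2%N))%N by lia.
- by case=> du dv; apply: single_edge_trivial uv du dv ntG.
- by case=> du dv; apply: no_path3 uv du dv.
- by case=> dv du; apply: no_path3 vu dv du.
Qed.

(** The handshake lemma in the line graph, summed through [deg_line_graph]; the 2 subtracted for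
    each edge of [G] is moved to the left-hand side. *)
Lemma card_edges_line_graph :
  (2 * #|edges (line_graph G)| + 2 * #|edges G|
     = \sum_(A in edges G) \sum_(v in A) deg v)%N.
Proof.
rewrite -handshake mulnC -sum_nat_const.
rewrite !(big_sub (mem (edges G))) -big_split /=.
apply: eq_bigr => A _; have [x [y [xy AE]]] := edgesP _ (valP A).
rewrite AE big_setU1 ?big_set1 ?inE ?adj_neq //= addn2.
by apply: deg_line_graph; rewrite ?adj_neq ?AE ?set21 ?set22.
Qed.

End Bounds.

(** * The index compared with the number of edges *)

Lemma ga_term_le1 (R : rcfType) (a b : R) : 0 <= a -> 0 <= b ->
  2 * Num.sqrt (a * b) / (a + b) <= 1.
Proof.
(* If the denominator vanishes, the quotient is 0, since the inverse of 0 is 0. *)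
move=> a0 b0; have [ab0|ab0] := eqVneq (a + b) 0.
  by rewrite ab0 invr0 mulr0.
have abp : 0 < a + b by rewrite lt_def ab0 addr_ge0.
rewrite ler_pdivrMr // mul1r -(@ler_pXn2r _ 2) ?nnegrE //; last exact: ltW.
  2: by rewrite mulr_ge0 ?sqrtr_ge0.
rewrite exprMn sqr_sqrtr ?mulr_ge0 //.
by have := sqr_ge0 (a - b); nra.
Qed.

Lemma ga_term_diag (R : rcfType) (a : R) : 0 < a ->
  2 * Num.sqrt (a * a) / (a + a) = 1.
Proof.
move=> a0; rewrite -expr2 sqrtr_sqr gtr0_norm //.
by rewrite mulr_natl mulr2n divff // lt0r_neq0 // addr_gt0.
Qed.

Section GA1.
Variables (R : rcfType) (G : sgraph).

Lemma GA1_le_card : GA1 R G <= #|edges G|%:R.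
Proof.
rewrite -sum1_card natr_sum; apply: ler_sum => A /edgesP[x [y [xy ->]]].
by rewrite !big_setU1 ?big_set1 ?inE ?adj_neq //= ga_term_le1 ?ler0n.
Qed.

Lemma GA1_eq_card : (forall x y : G, adj x y -> deg x = deg y) ->
  GA1 R G = #|edges G|%:R.
Proof.
move=> eq_deg; rewrite -sum1_card natr_sum; apply: eq_bigr => A.
move=> /edgesP[x [y [xy ->]]].
rewrite !big_setU1 ?big_set1 ?inE ?adj_neq //= -(eq_deg _ _ xy).
by apply: ga_term_diag; rewrite ltr0n (deg_gt0 xy).
Qed.

End GA1.

(** Two edges sharing [v] have other ends of equal degree by balance, hence equal degree sums. *)
Lemma line_graph_deg_eq (G : sgraph) :
  (forall u v w : G, adj u v -> adj v w -> deg u = deg w) ->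
  forall A B : line_graph G, adj A B -> deg A = deg B.
Proof.
move=> bal A B /andP[_ /set0Pn[v /setIP[vA vB]]].
have [x vx AE] := edge_otherP (valP A) vA.
have [y vy BE] := edge_otherP (valP B) vB.
have Ad : (deg A).+2 = (deg v + deg x)%N.
  by apply: deg_line_graph; rewrite ?adj_neq ?AE ?set21 ?set22.
have Bd : (deg B).+2 = (deg v + deg y)%N.
  by apply: deg_line_graph; rewrite ?adj_neq ?BE ?set21 ?set22.
have xv : adj x v by rewrite adj_sym.
by apply/eqP; rewrite -2!eqSS Ad Bd (bal _ _ _ xv vy).
Qed.

(** * Unions of cycles *)

Lemma deg_iso (G H : sgraph) (f : G -> H) : bijective f ->
  (forall x y, adj (f x) (f y) = adj x y) -> forall x, deg (f x) = deg x.
Proof.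
move=> f_bij fadj x; rewrite /deg -(card_imset _ (bij_inj f_bij)).
apply: eq_card => z; have [g fK gK] := f_bij.
rewrite inE -(gK z) (mem_imset _ _ (bij_inj f_bij)) inE.
by rewrite fadj.
Qed.

Lemma deg_cycle n (i : cycle_graph n) : deg i = 2%N.
Proof.
rewrite /deg (_ : [set j | adj i j] = [set ordS i; ord_pred i]).
  rewrite cards2; suff -> : ordS i != ord_pred i by [].
  (* Successor and predecessor differ because the length is at least 3; wrap-around occurs for the
     predecessor of 0 and for the successor of the last vertex. *)
  apply/eqP => /(congr1 val) /=; case: i => [[|k] /= lt_k].
    by rewrite !modn_small.
  rewrite modnDr (modn_small (ltnW lt_k)).
  move: lt_k; rewrite leq_eqVlt => /orP[/eqP [->]|lt_k]; first by rewrite modnn.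
  by rewrite modn_small //; lia.
apply/setP => j; rewrite !inE; congr (_ || _).
by apply/eqP/eqP => ->; rewrite ?ordSK ?ord_predK.
Qed.

Lemma deg_dunion (I : finType) (H : I -> sgraph) (u : dunion H) :
  deg u = deg (tagged u).
Proof.
case: u => i x /=; rewrite /deg.
have tag_inj : injective (fun y : H i => Tagged H y).
  by move=> y z /eqP; rewrite eq_Tagged => /eqP.
rewrite -(card_imset _ tag_inj); apply: eq_card => v; rewrite inE.
apply/andP/imsetP => [|[z + ->]].
  case: v => j y /= [/eqP ij].
  by case: _ / ij y => y; rewrite tagged_asE => xy; exists y; rewrite ?inE.
by rewrite inE /= eqxx tagged_asE.
Qed.

Lemma cycle_union_deg (G : sgraph) : cycle_union G -> forall x : G, deg x = 2%N.
Proof.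
move=> [I [n [f f_bij fadj]]] x.
by rewrite -(deg_iso f_bij fadj) deg_dunion deg_cycle.
Qed.

Lemma deg_path3_end : deg (ord0 : path_graph 3) = 1%N.
Proof.
apply/eqP/cards1P; exists (inord 1); apply/setP => y.
by rewrite !inE -val_eqE /= inordK //; case: y => [[|[|[|]]]].
Qed.

Lemma regular2_admissible (G : sgraph) : (forall x : G, deg x = 2%N) ->
  admissible G.
Proof.
move=> deg2.
have degC C (x : induced C) : C \in components G -> deg x = 2%N.
  move=> /imsetP[z _]; rewrite -/(component z) => CE.
  have xz : val x \in component z by rewrite -CE; apply: valP.
  by rewrite deg_induced // => y /(component_adj xz); rewrite -CE.
split=> C CG.
  (* With all degrees 2, a component has as many edges as vertices, and it contains a vertex
     together with a neighbour. *)
  have := handshake (induced C); rewrite (eq_bigr (fun=> 2%N)) => [|x _].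
    2: exact: degC.
  rewrite sum_nat_const card_sig mulnC => /eqP; rewrite eqn_pmul2l // => /eqP <-.
  have /imsetP[x _ CE] := CG.
  have /card_gt0P[y] : (0 < deg x)%N by rewrite deg2.
  rewrite inE => xy; have : #|[set x; y]| = 2%N by rewrite cards2 adj_neq.
  move=> <-; apply/subset_leq_card/subsetP => z; rewrite [C]CE => /set2P[] ->.
    exact: mem_component.
  exact: component_adj (mem_component x) xy.
split; first by left; exists 2%N => x; apply: degC.
(* An isomorphism preserves degrees, but an end of the path has degree 1. *)
case=> f f_bij fadj; have [g fK gK] := f_bij.
by have := deg_path3_end; rewrite -(gK ord0) (deg_iso f_bij fadj) degC.
Qed.

Theorem theorem3p8 (R : rcfType) :
  (forall G : sgraph, admissible G -> GA1 R (line_graph G) >= GA1 R G) /\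
  (forall G : sgraph, cycle_union G ->
     admissible G /\ GA1 R (line_graph G) = GA1 R G).
Proof.
split=> G.
  move=> admG; apply: le_trans (GA1_le_card R G) _.
  have bal := balanced_of_components (fun C CG => proj1 (proj2 admG C CG)).
  rewrite (GA1_eq_card _ (line_graph_deg_eq bal)) ler_nat.
  have : (4 * #|edges G| <= \sum_(A in edges G) \sum_(v in A) deg v)%N.
    rewrite mulnC -sum_nat_const; apply: leq_sum => A /edgesP[x [y [xy ->]]].
    by rewrite big_setU1 ?big_set1 ?inE ?adj_neq //= admissible_deg_sum.
  (* The double sum is [2 * #|edges (line_graph G)| + 2 * #|edges G|], so the bound reduces to
     comparing edge counts. *)
  by rewrite -card_edges_line_graph; lia.
move/cycle_union_deg=> deg2; split; first exact: regular2_admissible.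
rewrite !GA1_eq_card => [|x y _|]; last first.
- by apply: line_graph_deg_eq => u v w _ _; rewrite !deg2.
- by rewrite !deg2.
congr _%:R; have := card_edges_line_graph G.
(* Every edge now has degree sum exactly 4, which makes the two edge counts equal. *)
rewrite (eq_bigr (fun=> 4%N)) ?sum_nat_const => [|A AE]; first by lia.
rewrite (eq_bigr (fun=> 2%N)) => [|x _]; last exact: deg2.
by rewrite sum_nat_const card_edge.
Qed.
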